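(* The chase of a rule set $\mathcal{R}$ terminates if the chase of the TGD set $\mathsf{St}(\mathcal{R})$ terminates.
   Context: Rules are function- and constant-free first-order formulas of two kinds: tuple generating dependencies (TGDs) $\forall \vec{x},\vec{y}.(\beta[\vec{x},\vec{y}] \to \exists \vec{w}.\eta[\vec{x},\vec{w}])$ and equality generating dependencies (EGDs) $\forall \vec{x}.(\beta[\vec{x}] \to x \approx y)$ with $x,y \in \vec{x}$, where $\beta,\eta$ are non-empty conjunctions of atoms not using the equality predicate $\approx$. A rule set is a finite set of rules; an ontology is a pair $\langle \mathcal{R}, \mathcal{F}\rangle$ of a rule set and an equality-free fact set whose predicates occur in $\mathcal{R}$. The (non-oblivious, Skolem) chase builds a sequence $\mathcal{A}_0=\mathcal{F}, \mathcal{A}_1,\ldots$: a TGD with a substitution $\sigma$ mapping its body into the current set is applicable if no extension of $\sigma$ maps its head into the current set, and its application adds the head with each existential variable $w$ replaced by a Skolem term $f_w(\sigma(\vec{x}))$; an EGD with body match $\sigma$ and $\sigma(x)\neq\sigma(y)$ is applied by replacing one of $\sigma(x),\sigma(y)$ by the other everywhere (merging the deeper term into the shallower one according to a fixed strict total order on terms compatible with term depth). Sequences must be fair (every applicable rule/substitution pair eventually becomes inapplicable). The chase of an ontology terminates if all its chase sequences are finite; the chase of a rule set $\mathcal{R}$ terminates if for every fact set $\mathcal{F}$ the chase of $\langle\mathcal{R},\mathcal{F}\rangle$ terminates. The standard axiomatisation $\mathsf{St}(\mathcal{R})$ is the TGD set obtained from $\mathcal{R}$ by keeping all TGDs, replacing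 each EGD $\beta \to x\approx y$ by $\beta \to \mathsf{EQ}(x,y)$ for a fresh binary predicate $\mathsf{EQ}$, and adding: for every predicate $P\neq\approx$ of $\mathcal{R}$ (of arity $n$) the reflexivity rule $P(x_1,\ldots,x_n) \to \bigwedge_{i} \mathsf{EQ}(x_i,x_i)$; the symmetry rule $\mathsf{EQ}(x,y)\to\mathsf{EQ}(y,x)$; the transitivity rule $\mathsf{EQ}(x,y)\wedge\mathsf{EQ}(y,z)\to\mathsf{EQ}(x,z)$; and for every such $P$ and position $i$ the replacement rule $P(x_1,\ldots,x_n)\wedge\mathsf{EQ}(x_i,x_i') \to P(x_1,\ldots,x_n)[x_i/x_i']$. *)

(* Defs.v *)
From mathcomp Require Import all_boot.
From mathcomp Require Import boolp classical_sets cardinality.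

Set Implicit Arguments.
Unset Strict Implicit.
Unset Printing Implicit Defensive.

Local Open Scope classical_set_scope.

(* The equality predicate is not a symbol of the signature: it only shows up
   as the (syntactic) conclusion of an EGD. *)
Record signature := Signature { psym :> eqType; arity : psym -> nat }.

Definition var := nat.

Definition atom (S : signature) (T : Type) : Type := (psym S * seq T)%type.

Definition subst_atom (S : signature) (T U : Type) (s : T -> U) (a : atom S T) :
  atom S U := (a.1, map s a.2).

Definition vars (S : signature) (b : seq (atom S var)) : seq var :=
  undup (flatten [seq a.2 | a <- b]).

(* The quantifier prefix of a TGD is implicit: the variables of the body are
   universal, and those that only occur in the head are existential. *)
Record tgd (S : signature) := Tgd {
  tgd_body : seq (atom S var);
  tgd_head : seq (atom S var) }.

Record egd (S : signature) := Egd {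
  egd_body : seq (atom S var);
  egd_lhs : var;
  egd_rhs : var }.

Inductive rule (S : signature) := TGD of tgd S | EGD of egd S.

Definition body (S : signature) (r : rule S) : seq (atom S var) :=
  match r with TGD d => tgd_body d | EGD e => egd_body e end.

Definition rule_atoms (S : signature) (r : rule S) : seq (atom S var) :=
  match r with
  | TGD d => tgd_body d ++ tgd_head d
  | EGD e => egd_body e
  end.

Definition occurs (S : signature) (R : set (rule S)) (P : S) : Prop :=
  exists2 r, R r & P \in [seq a.1 | a <- rule_atoms r].

Definition wf_rule (S : signature) (r : rule S) : Prop :=
  all (fun a => size a.2 == arity a.1) (rule_atoms r) /\
  match r with
  | TGD d => tgd_body d <> [::] /\ tgd_head d <> [::]
  | EGD e => [/\ egd_body e <> [::], egd_lhs e \in vars (egd_body e)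
               & egd_rhs e \in vars (egd_body e)]
  end.

Definition rule_set (S : signature) (R : set (rule S)) : Prop :=
  finite_set R /\ forall r, R r -> wf_rule r.

(* Ground terms. Skolem [d w ts] is f_w(ts); indexing the Skolem symbol by the
   TGD d as well as by w makes the symbols of distinct TGDs distinct without
   having to rename rules apart. *)
Inductive term (S : signature) : Type :=
| Const of nat
| Skolem of tgd S & var & seq (term S).

Fixpoint depth (S : signature) (t : term S) : nat :=
  match t with
  | Const _ => 0
  | Skolem _ _ ts => (foldr maxn 0 (map (@depth S) ts)).+1
  end.

Definition is_const (S : signature) (t : term S) : bool :=
  if t is Const _ then true else false.

Record term_order (S : signature) (lt : term S -> term S -> Prop) : Prop := {
  term_order_irr : forall t, ~ lt t t;
  term_order_trans : forall t u v, lt t u -> lt u v -> lt t v;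
  term_order_total : forall t u, t <> u -> lt t u \/ lt u t;
  term_order_depth : forall t u, depth t < depth u -> lt t u }.

Definition fact (S : signature) : Type := atom S (term S).

(* The facts of an ontology are built from constants only: the Skolem symbols,
   being fresh, do not occur in them. *)
Definition fact_set (S : signature) (R : set (rule S)) (F : set (fact S)) :
    Prop :=
  finite_set F /\
  forall a, F a -> [/\ occurs R a.1, size a.2 = arity a.1 & all (@is_const S) a.2].

Definition matches (S : signature) (s : var -> term S)
    (b : seq (atom S var)) (A : set (fact S)) : Prop :=
  forall a, a \in b -> A (subst_atom s a).

(* Substitutions are total functions; only the values of s on the variables
   of the body matter, and an extension of s is an s' that agrees with s there. *)
Definition applicable (S : signature) (r : rule S) (s : var -> term S)
    (A : set (fact S)) : Prop :=
  matches s (body r) A /\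
  match r with
  | TGD d => ~ exists2 s' : var -> term S,
                 (forall v, v \in vars (tgd_body d) -> s' v = s v)
               & matches s' (tgd_head d) A
  | EGD e => s (egd_lhs e) <> s (egd_rhs e)
  end.

Definition frontier (S : signature) (d : tgd S) : seq var :=
  [seq v <- vars (tgd_head d) | v \in vars (tgd_body d)].

Definition skolemize (S : signature) (d : tgd S) (s : var -> term S) (v : var) :
  term S :=
  if v \in vars (tgd_body d) then s v else Skolem d v (map s (frontier d)).

(* Terms act as names of the elements of a fact set, so t is replaced by u
   as an argument of facts and not inside the Skolem terms that name other
   elements. *)
Definition replace_term (S : signature) (t u : term S) (A : set (fact S)) :
    set (fact S) :=
  [set subst_atom (fun v => if `[< v = t >] then u else v) a | a in A].

Definition apply_rule (S : signature) (lt : term S -> term S -> Prop) (r : rule S)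
    (s : var -> term S) (A : set (fact S)) : set (fact S) :=
  match r with
  | TGD d => A `|` [set subst_atom (skolemize d s) a | a in [set` tgd_head d]]
  | EGD e =>
      let t := s (egd_lhs e) in
      let u := s (egd_rhs e) in
      if `[< lt t u >] then replace_term u t A else replace_term t u A
  end.

(* A possibly infinite sequence is encoded as a map from nat into an option
   type, with value None from the end of the sequence on. *)
Record chase_sequence (S : signature) (lt : term S -> term S -> Prop)
    (R : set (rule S)) (F : set (fact S)) (A : nat -> option (set (fact S))) :
    Prop := {
  chase_start : A 0 = Some F;
  chase_step : forall i B', A i.+1 = Some B' ->
    exists B r s,
      [/\ A i = Some B, R r, applicable r s B & B' = apply_rule lt r s B];
  chase_fair : forall i B r s, A i = Some B -> R r -> applicable r s B ->
    exists j B', [/\ i < j, A j = Some B' & ~ applicable r s B'] }.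

Definition finite_sequence (T : Type) (A : nat -> option T) : Prop :=
  exists n, A n = None.

Definition ontology_terminates (S : signature) (lt : term S -> term S -> Prop)
    (R : set (rule S)) (F : set (fact S)) : Prop :=
  forall A, chase_sequence lt R F A -> finite_sequence A.

Definition chase_terminates (S : signature) (lt : term S -> term S -> Prop)
    (R : set (rule S)) : Prop :=
  forall F, fact_set R F -> ontology_terminates lt R F.

(* x_1, ..., x_n are the variables 0, ..., n - 1, and the additional variable
   of a replacement rule is n. For a nullary P the head of the reflexivity rule
   would be an empty conjunction, so there is no such rule. *)
Inductive St (S : signature) (EQ : S) (R : set (rule S)) : set (rule S) :=
| St_tgd d : R (TGD d) -> St EQ R (TGD d)
| St_egd e : R (EGD e) ->
    St EQ R (TGD (Tgd (egd_body e) [:: (EQ, [:: egd_lhs e; egd_rhs e])]))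
| St_refl P : occurs R P -> 0 < arity P ->
    St EQ R (TGD (Tgd [:: (P, iota 0 (arity P))]
                      [seq (EQ, [:: i; i]) | i <- iota 0 (arity P)]))
| St_sym :
    St EQ R (TGD (Tgd [:: (EQ, [:: 0; 1])] [:: (EQ, [:: 1; 0])]))
| St_trans :
    St EQ R (TGD (Tgd [:: (EQ, [:: 0; 1]); (EQ, [:: 1; 2])]
                      [:: (EQ, [:: 0; 2])]))
| St_repl P i : occurs R P -> i < arity P ->
    St EQ R (TGD (Tgd [:: (P, iota 0 (arity P)); (EQ, [:: i; arity P])]
                      [:: (P, set_nth 0 (iota 0 (arity P)) i (arity P))])).

(* Main.v *)
(* An infinite chase sequence A_0, A_1, ... of R is turned into one of St(R) that
   applies the same rules with the same substitutions and saturates under the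
   equality axioms after each step, which takes finitely many steps. After i
   rounds the latter has a fact set C_i that contains A_i and whose quotient by
   EQ is A_i: the map rep_i composing all merges sends C_i onto A_i and fixes
   the elements of A_i. Hence applicability in A_i transfers to C_i, because an
   extension into C_i composed with rep_i is one into A_i. A merged term is never
   recreated by a TGD, as its Skolem term certifies that the head was already
   satisfied.
   For fairness, a match s in C_i yields the matches rep_j o s in A_j. They are
   eventually constant, since merging goes down the term order and never
   increases depth, and there are finitely many terms of bounded depth. Fairness
   of the given sequence makes the limit match inapplicable in some A_j, and then
   s is inapplicable in C_j as C_j is closed under replacement. *)

Require Import Defs.
From HB Require Import structures.
From mathcomp Require Import all_boot.
From mathcomp Require Import boolp classical_sets cardinality.

Set Implicit Arguments.
Unset Strict Implicit.
Unset Printing Implicit Defensive.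

Local Open Scope classical_set_scope.

HB.instance Definition _ (S : signature) := gen_eqMixin (term S).
HB.instance Definition _ (S : signature) := gen_choiceMixin (term S).

(** * Lists, finite sets and infinite sequences of steps *)

Lemma set_nth_cat (T : Type) (x0 : T) p t q u :
  set_nth x0 (p ++ t :: q) (size p) u = p ++ u :: q.
Proof. by elim: p => //= a p ->. Qed.

Lemma set_nth_self (T : Type) (x0 : T) l i :
  i < size l -> set_nth x0 l i (nth x0 l i) = l.
Proof. by elim: l i => // a l IH [|i] //= /IH ->. Qed.

Lemma mem_set_nth (T : eqType) (x0 : T) l i u y :
  i < size l -> y \in set_nth x0 l i u -> y = u \/ y \in l.
Proof.
elim: l i => // a l IH [|i] /=; rewrite !inE.
  by move=> _ /orP[/eqP|->]; [left|right; rewrite orbT].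
move=> hi /orP[->|]; first by right.
by case/(IH _ hi); [left|right; apply/orP; right].
Qed.

Lemma map_set_nth (T U : Type) (f : T -> U) x0 l i u :
  i < size l -> map f (set_nth x0 l i u) = set_nth (f x0) (map f l) i (f u).
Proof. by elim: l i => // a l IH [|i] //= /IH ->. Qed.

Lemma count_ltn (T : eqType) (p q : pred T) (u : seq T) x :
  x \in u -> p x -> ~~ q x -> subpred q p -> count q u < count p u.
Proof.
move=> + px qx sqp; elim: u => // y u IH; rewrite inE /= => /orP[/eqP<-|/IH lt].
  by rewrite px (negbTE qx) add0n add1n ltnS; apply: sub_count.
rewrite -addnS; apply: leq_add => //.
by case: (q y) (sqp y) => // ->.
Qed.

Lemma finite_lists (T : choiceType) (D : set T) (n : nat) : finite_set D ->
  finite_set [set l : seq T | size l = n /\ forall t, t \in l -> D t].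
Proof.
move=> fD; elim: n => [|n IH].
  apply: (@sub_finite_set _ _ [set [::]]); last exact: finite_set1.
  by move=> l [/size0nil ->].
apply: sub_finite_set (finite_image2 (fun t l => t :: l) fD IH).
move=> [|t l] [//= [sl] Dl]; exists t; first by apply: Dl; rewrite mem_head.
exists l => //; split=> // v vl; apply: Dl; by rewrite inE vl orbT.
Qed.

(* A sequence whose members lie in a finite set and which only ever moves down
   a strict order is eventually constant: each move strictly decreases the
   number of elements of the finite set below the current member. *)
Lemma descending_stabilises (T : choiceType) (lt : T -> T -> Prop) (V : set T)
    (x : nat -> T) k :
  (forall t, ~ lt t t) -> (forall t u v, lt t u -> lt u v -> lt t v) ->
  finite_set V -> (forall j, k <= j -> V (x j)) ->
  (forall j, x j.+1 = x j \/ lt (x j.+1) (x j)) ->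
  exists2 N, k <= N & forall j, N <= j -> x j = x N.
Proof.
move=> irr tr /finite_seqP[s ->] Vx st.
have mono i j : i <= j -> x j = x i \/ lt (x j) (x i).
  move=> /subnK <-; elim: (j - i) => [|d IH]; first by left.
  rewrite addSn; case: (st (d + i)) => [->//|l].
  by right; case: IH => [<-//|]; apply: tr.
pose m j := count (fun v => `[< lt v (x j) >]) s.
have [n] := ubnP (m k); elim: n k Vx => // n IH k Vx; rewrite ltnS => le.
case: (pselect (forall j, k <= j -> x j = x k)) => [h|]; first by exists k.
move=> /existsNP[j] /not_implyP[kj neq].
case: (mono _ _ kj) => [//|ltj].
have mlt : m j < m k.
  apply: (@count_ltn _ _ _ _ (x j)); first exact: Vx.
  - exact/asboolP.
  - exact/asboolP/irr.
  - by move=> v /asboolP h; apply/asboolP; apply: tr h ltj.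
have [|N jN hN] := IH j _ (leq_trans mlt le).
  by move=> i ji; apply: Vx; apply: leq_trans ji.
by exists N => //; apply: leq_trans jN.
Qed.

(* Concatenates finite segments of steps into one infinite sequence. *)
Lemma flatten_steps (T : Type) (e : rel T) (x0 : T) (l0 : seq T) (B : nat -> T)
    (segs : nat -> seq T) :
  path e x0 l0 -> last x0 l0 = B 0 ->
  (forall i, [/\ 0 < size (segs i), path e (B i) (segs i)
               & last (B i) (segs i) = B i.+1]) ->
  exists2 C : nat -> T, C 0 = x0 /\ (forall k, e (C k) (C k.+1))
    & exists2 n : nat -> nat, (forall i, i <= n i) & forall i, C (n i) = B i.
Proof.
move=> p0 h0 h.
pose full k := l0 ++ flatten (mkseq segs k).
have fullS k : full k.+1 = full k ++ segs k.
  by rewrite /full mkseqS flatten_rcons catA.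
have fullP k : path e x0 (full k) /\ last x0 (full k) = B k.
  elim: k => [|k [IH1 IH2]]; first by rewrite /full cats0.
  by rewrite fullS cat_path last_cat IH1 IH2; case: (h k) => _ -> ->.
have size_full k : k <= size (full k).
  elim: k => // k IH; rewrite fullS size_cat -addn1.
  by apply: leq_add => //; case: (h k).
have stab k m : k <= m -> forall i, i <= size (full k) ->
    nth x0 (x0 :: full m) i = nth x0 (x0 :: full k) i.
  move=> /subnK <-; elim: (m - k) => // d IH i hi.
  rewrite addSn fullS -IH // -cat_cons nth_cat ifT //= ltnS.
  apply: leq_trans hi _.
  by elim: {IH} d => // d IH; rewrite addSn fullS size_cat (leq_trans IH) ?leq_addr.
exists (fun k => nth x0 (x0 :: full k) k).
  split=> // k; rewrite -(stab k k.+1) //.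
  have /pathP -/(_ x0 k) := (fullP k.+1).1.
  by apply; apply: size_full.
exists (fun i => size (full i)) => // i.
by rewrite (stab i) // -last_nth; case: (fullP i).
Qed.

Section Rules.
Variables (S : signature) (lt : term S -> term S -> Prop) (EQ : S).
Variable R : set (rule S).
Hypothesis lt_order : term_order lt.
Hypothesis R_rules : rule_set R.
Hypothesis arity_EQ : arity EQ = 2.
Hypothesis EQ_fresh : ~ occurs R EQ.

Implicit Types (A C : set (fact S)) (d : tgd S) (s : var -> term S).

(** * Substitutions, matches and TGDs without existential variables *)

Lemma subst_atom_comp (T U V : Type) (f : U -> V) (g : T -> U) (a : atom S T) :
  subst_atom f (subst_atom g a) = subst_atom (f \o g) a.
Proof. by rewrite /subst_atom /= map_comp. Qed.

Lemma eq_subst_atom (T : eqType) (U : Type) (f g : T -> U) (a : atom S T) :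
  {in a.2, f =1 g} -> subst_atom f a = subst_atom g a.
Proof. by move=> h; rewrite /subst_atom; congr pair; apply/eq_in_map. Qed.

Lemma subst_atom_fixed (T : eqType) (f : T -> T) (a : atom S T) :
  {in a.2, f =1 id} -> subst_atom f a = a.
Proof. by case: a => P l h; rewrite /subst_atom (map_id_in h). Qed.

Lemma varsP (b : seq (atom S var)) v :
  reflect (exists2 a, a \in b & v \in a.2) (v \in vars b).
Proof.
rewrite mem_undup; apply: (iffP flattenP) => [[l /mapP[a ab ->] va]|[a ab va]].
  by exists a.
by exists a.2 => //; apply: map_f.
Qed.

Lemma matches_ext s s' (b : seq (atom S var)) C :
  {in vars b, s =1 s'} -> matches s b C -> matches s' b C.
Proof.
move=> h m a ab; rewrite -(@eq_subst_atom _ _ s s'); first exact: m.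
by move=> v va; apply: h; apply/varsP; exists a.
Qed.

Lemma sub_matches s (b : seq (atom S var)) C C' :
  C `<=` C' -> matches s b C -> matches s b C'.
Proof. by move=> h m a /m /h. Qed.

Lemma egd_vars e : R (EGD e) ->
  egd_lhs e \in vars (egd_body e) /\ egd_rhs e \in vars (egd_body e).
Proof. by move=> Re; have [_ []] := R_rules.2 _ Re. Qed.

Lemma applicable_ext r s s' C : R r ->
  {in vars (body r), s =1 s'} -> applicable r s C -> applicable r s' C.
Proof.
move=> Rr h [m ap]; split; first exact: matches_ext m.
case: r Rr h m ap => [d|e] Rr /= h _.
  by apply: contra_not => -[s2 h2 m2]; exists s2 => // v hv; rewrite h2 ?h.
have [hl hr] := egd_vars Rr.
by rewrite -!h.
Qed.

Lemma frontierP d v :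
  (v \in frontier d) = (v \in vars (tgd_head d)) && (v \in vars (tgd_body d)).
Proof. by rewrite mem_filter andbC. Qed.

(** Shared by all rules that [St] adds to the TGDs of [R]: they invent no terms, and applicability
    just says that the head is not matched. *)
Definition datalog d := {subset vars (tgd_head d) <= vars (tgd_body d)}.

Lemma datalog_skolemize d s a : datalog d -> a \in tgd_head d ->
  subst_atom (skolemize d s) a = subst_atom s a.
Proof.
move=> hd ah; apply: eq_subst_atom => v va; rewrite /skolemize ifT //.
by apply: hd; apply/varsP; exists a.
Qed.

Lemma apply_datalog d s C : datalog d ->
  apply_rule lt (TGD d) s C =
  C `|` [set subst_atom s a | a in [set` tgd_head d]].
Proof.
move=> hd /=; congr (_ `|` _); apply/seteqP.
by split=> _ [a ah <-]; exists a => //; rewrite datalog_skolemize.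
Qed.

Lemma datalog_applicable d s C : datalog d -> matches s (tgd_body d) C ->
  applicable (TGD d) s C <-> ~ matches s (tgd_head d) C.
Proof.
move=> hd m; split=> [[_ ap]|nm]; first by apply: contra_not ap => h; exists s.
split=> // -[s' h m']; apply: nm; apply: matches_ext m' => v hv.
by apply: h; apply: hd.
Qed.

(** * The rules of [St] and fact sets closed under the equality axioms *)

Definition egd_tgd (e : egd S) :=
  Tgd (egd_body e) [:: (EQ, [:: egd_lhs e; egd_rhs e])].

Lemma egd_tgd_datalog e : R (EGD e) -> datalog (egd_tgd e).
Proof.
move=> /egd_vars[hl hr] v /varsP[a]; rewrite mem_seq1 => /eqP -> /=.
by rewrite !inE => /orP[]/eqP->.
Qed.

(** Split off from [St] because saturation applies these rules only. *)
Inductive eq_axiom : tgd S -> Prop :=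
| Eq_refl P : occurs R P -> 0 < arity P ->
    eq_axiom (Tgd [:: (P, iota 0 (arity P))]
                  [seq (EQ, [:: i; i]) | i <- iota 0 (arity P)])
| Eq_sym : eq_axiom (Tgd [:: (EQ, [:: 0; 1])] [:: (EQ, [:: 1; 0])])
| Eq_trans :
    eq_axiom (Tgd [:: (EQ, [:: 0; 1]); (EQ, [:: 1; 2])] [:: (EQ, [:: 0; 2])])
| Eq_repl P i : occurs R P -> i < arity P ->
    eq_axiom (Tgd [:: (P, iota 0 (arity P)); (EQ, [:: i; arity P])]
                  [:: (P, set_nth 0 (iota 0 (arity P)) i (arity P))]).

Lemma eq_axiom_St d : eq_axiom d -> St EQ R (TGD d).
Proof. by case=> *; [apply: St_refl|apply: St_sym|apply: St_trans|apply: St_repl]. Qed.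

Lemma StP r : St EQ R r ->
  exists2 d, r = TGD d & [\/ R (TGD d), (exists2 e, R (EGD e) & d = egd_tgd e)
                           | eq_axiom d].
Proof.
case=> [d Rd|e Re|P o n|||P i o n]; eexists; try by [].
- by constructor 1.
- by constructor 2; exists e.
- by constructor 3; apply: Eq_refl.
- by constructor 3; apply: Eq_sym.
- by constructor 3; apply: Eq_trans.
- by constructor 3; apply: Eq_repl.
Qed.

Lemma eq_axiom_datalog d : eq_axiom d -> datalog d.
Proof.
case=> [P o n|||P i o n] v /varsP[a]; rewrite /= ?mem_seq1.
- case/mapP=> i hi -> /=; rewrite !inE orbb => /eqP->.
  by apply/varsP; exists (P, iota 0 (arity P)); rewrite ?mem_seq1.
- by move/eqP=> -> /=; rewrite !inE => /orP[]/eqP->.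
- by move/eqP=> -> /=; rewrite !inE => /orP[]/eqP->.
- move/eqP=> -> /= /mem_set_nth[|->|vi]; first by rewrite size_iota.
    by apply/varsP; exists (EQ, [:: i; arity P]); rewrite !inE eqxx orbT.
  by apply/varsP; exists (P, iota 0 (arity P)); rewrite ?inE ?eqxx.
Qed.

Definition eq_closed C := forall d s,
  eq_axiom d -> matches s (tgd_body d) C -> matches s (tgd_head d) C.

Lemma closed_refl C P l t : eq_closed C -> occurs R P -> size l = arity P ->
  C (P, l) -> t \in l -> C (EQ, [:: t; t]).
Proof.
move=> cl o sl Cl tl.
have n0 : 0 < arity P by rewrite -sl; case: (l) tl.
(* Variable [i] stands for the [i]-th argument, so [index t l] is a variable with value [t]. *)
have := cl _ (nth t l) (Eq_refl o n0) _ (EQ, [:: index t l; index t l]).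
rewrite /subst_atom /= nth_index //; apply.
  move=> a; rewrite mem_seq1 => /eqP->; rewrite /subst_atom /=.
  by rewrite map_nth_iota0 -sl // take_size.
by apply: map_f; rewrite mem_iota add0n -sl index_mem.
Qed.

Lemma closed_sym C t u : eq_closed C ->
  C (EQ, [:: t; u]) -> C (EQ, [:: u; t]).
Proof.
move=> cl h.
apply: (cl _ (nth t [:: t; u]) Eq_sym _ (EQ, [:: 1; 0])); last exact: mem_head.
by move=> a; rewrite mem_seq1 => /eqP->.
Qed.

Lemma closed_trans C t u v : eq_closed C ->
  C (EQ, [:: t; u]) -> C (EQ, [:: u; v]) -> C (EQ, [:: t; v]).
Proof.
move=> cl h1 h2.
apply: (cl _ (nth t [:: t; u; v]) Eq_trans _ (EQ, [:: 0; 2]));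
  last exact: mem_head.
by move=> a; rewrite !inE => /orP[]/eqP->.
Qed.

Lemma closed_repl C P p t q u : eq_closed C -> occurs R P ->
  size (p ++ t :: q) = arity P ->
  C (P, p ++ t :: q) -> C (EQ, [:: t; u]) -> C (P, p ++ u :: q).
Proof.
move=> cl o sl C1 C2; set l := p ++ t :: q in sl C1.
have hp : size p < arity P by rewrite -sl /l size_cat /= addnS ltnS leq_addr.
(* The arguments in [l] are the values of variables [0] to [arity P - 1]; the appended [u] is that
   of the extra variable [arity P]. *)
pose s := nth t (rcons l u).
have sn : s (arity P) = u by rewrite /s nth_rcons sl ltnn eqxx.
have si : s (size p) = t.
  by rewrite /s nth_rcons sl hp /l nth_cat ltnn subnn.
have sl' : map s (iota 0 (arity P)) = l.
  rewrite /s map_nth_iota0; last by rewrite size_rcons sl.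
  by rewrite -sl -cats1 take_size_cat.
have := cl _ s (Eq_repl o hp) _ _ (mem_head _ _).
rewrite /subst_atom /= map_set_nth ?size_iota // sl' sn set_nth_cat; apply.
by move=> a; rewrite !inE => /orP[]/eqP->; rewrite /subst_atom /= ?sl' ?si ?sn.
Qed.

(** A replacement rule changes a single argument, so the arguments are exchanged from left to right,
    [p] being the prefix already treated. *)
Lemma closed_subst C (T : eqType) (f g : T -> term S) (a : atom S T) :
  eq_closed C -> occurs R a.1 -> size a.2 = arity a.1 ->
  {in a.2, forall v, C (EQ, [:: f v; g v])} ->
  C (subst_atom f a) -> C (subst_atom g a).
Proof.
case: a => P x /= cl o sx; rewrite /subst_atom /=.
suff H p : size (p ++ map f x) = arity P ->
    {in x, forall v, C (EQ, [:: f v; g v])} ->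
    C (P, p ++ map f x) -> C (P, p ++ map g x).
  by apply: (H [::]); rewrite size_map.
elim: x {sx} p => //= v x IH p sz h C1.
rewrite -cat_rcons; apply: IH.
- by rewrite cat_rcons -sz !size_cat.
- by move=> w wx; apply: h; rewrite inE wx orbT.
- rewrite cat_rcons; apply: closed_repl C1 _ => //; apply: h; exact: mem_head.
Qed.

(** * Finiteness of terms and facts, and the invariant relating the two chases *)

Variable F : set (fact S).
Hypothesis F_facts : fact_set R F.

(** An upper bound on the terms that can arise from [F]. There are infinitely many constants, so
    bounding the depth alone would not give a finite set. *)
Inductive chase_term : term S -> Prop :=
| Chase_const a t : F a -> t \in a.2 -> chase_term t
| Chase_skolem d w ts : R (TGD d) -> w \in vars (tgd_head d) ->
    size ts = size (frontier d) -> (forall t, t \in ts -> chase_term t) ->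
    chase_term (Skolem d w ts).

Lemma depth_arg d w ts (t : term S) :
  t \in ts -> depth t < depth (Skolem d w ts).
Proof.
rewrite /= ltnS; elim: ts => //= u ts IH; rewrite inE leq_max.
by case/orP=> [/eqP->|/IH ->]; rewrite ?leqnn ?orbT.
Qed.

(** Induction on [k]: a term is a constant of [F], or one of finitely many Skolem symbols applied to
    a list of fixed length over the finite set [D] of shallower terms. *)
Lemma finite_chase_terms k :
  finite_set [set t | chase_term t /\ depth t < k].
Proof.
elim: k => [|k IH]; first by apply: sub_finite_set (finite_set0 _) => t [].
set D := [set t | _] in IH.
pose sk (r : rule S) : set (term S) := match r with
  | TGD d => [set Skolem d w ts | w in [set` vars (tgd_head d)] &
               ts in [set ts | size ts = size (frontier d) /\
                               forall t, t \in ts -> D t]]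
  | EGD _ => set0
  end.
apply: (@sub_finite_set _ _ ((\bigcup_(a in F) [set` a.2]) `|` \bigcup_(r in R) sk r)).
  move=> _ [[a t Fa ta _|d w ts Rd wd sts cts dep]]; first by left; exists a.
  right; exists (TGD d) => //; exists w => //; exists ts => //; split=> // t tts.
  by split; [apply: cts|apply: leq_trans (depth_arg d w tts) _].
rewrite finite_setU; split.
  by apply: bigcup_finite => [|a _]; [case: F_facts|apply: finite_seq].
apply: bigcup_finite => [|[d|e] _]; [by case: R_rules| |exact: finite_set0].
by apply: finite_image2; [apply: finite_seq|apply: finite_lists].
Qed.

(* The elements of a fact set; EQ-facts do not contribute. *)
Definition dom C (t : term S) : Prop :=
  exists a, [/\ C a, a.1 <> EQ & t \in a.2].

Lemma sub_dom C C' : C `<=` C' -> dom C `<=` dom C'.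
Proof. by move=> h t [a [Ca n ta]]; exists a; split=> //; apply: h. Qed.

Lemma finite_dom C : finite_set C -> finite_set (dom C).
Proof.
move=> fC; apply: (@sub_finite_set _ _ (\bigcup_(a in C) [set` a.2])).
  by move=> t [a [Ca _ ta]]; exists a.
by apply: bigcup_finite => // a _; apply: finite_seq.
Qed.

(** The finite universe in which saturation takes place. *)
Definition facts_over (D : set (term S)) : set (fact S) :=
  [set a | [/\ occurs R a.1 \/ a.1 = EQ, size a.2 = arity a.1
             & forall t, t \in a.2 -> D t]].

Lemma finite_facts_over D : finite_set D -> finite_set (facts_over D).
Proof.
move=> fD.
pose preds : set S := (\bigcup_(r in R) [set` [seq a.1 | a <- rule_atoms r]]) `|` [set EQ].
apply: (@sub_finite_set _ _ (\bigcup_(P in preds)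
  (pair P @` [set l | size l = arity P /\ forall t, t \in l -> D t]))).
  move=> [P l] [/= oP sl Dl]; exists P; last by exists l.
  by case: oP => [[r Rr hP]|e]; [left; exists r|right].
apply: bigcup_finite => [|P _]; last exact/finite_image/finite_lists.
rewrite finite_setU; split; last exact: finite_set1.
by apply: bigcup_finite => [|r _]; [case: R_rules|apply: finite_seq].
Qed.

(* A is a fact set of an R-chase, C one of an St(R)-chase, and rep sends each
   term of C to the element of A it has been merged into. Clauses sim_sub and
   sim_dom speak of all eq_closed extensions of C so that they survive in the
   middle of a saturation. By sim_skolem, a term that is present in C cannot be
   introduced anew, even if it has been merged away in A. *)
Record simulates A C (rep : term S -> term S) : Prop := {
  sim_fin : finite_set C;
  sim_occurs : forall a, C a -> a.1 <> EQ -> occurs R a.1;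
  sim_arity : forall a, C a -> size a.2 = arity a.1;
  sim_fact : forall a, A a -> occurs R a.1 /\ size a.2 = arity a.1;
  sim_sub : forall C', C `<=` C' -> eq_closed C' -> A `<=` C';
  sim_rep : forall a, C a -> a.1 <> EQ -> A (subst_atom rep a);
  sim_eq : forall t u, C (EQ, [:: t; u]) -> [/\ dom C t, dom C u & rep t = rep u];
  sim_dom : forall t, dom C t -> forall C', C `<=` C' -> eq_closed C' ->
    C' (EQ, [:: t; rep t]);
  sim_fixed : forall t, dom A t -> rep t = t;
  sim_id : forall t, ~ dom C t -> rep t = t;
  sim_skolem : forall d w ts, dom C (Skolem d w ts) ->
    exists2 s, ts = map s (frontier d) & matches (skolemize d s) (tgd_head d) C;
  sim_term : forall t, dom C t -> chase_term t }.

(** * The invariant at the start and under saturation *)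

Lemma occurs_neq P : occurs R P -> P <> EQ.
Proof. by move=> h e; apply: EQ_fresh; rewrite -e. Qed.

Lemma simulates_start : simulates F F id.
Proof.
have neq a : F a -> a.1 <> EQ by case/F_facts.2 => /occurs_neq.
split=> //; first by case: F_facts.
- by move=> a /F_facts.2[].
- by move=> a /F_facts.2[].
- by move=> a /F_facts.2[].
- by move=> a Fa _; rewrite subst_atom_fixed.
- by move=> t u /neq.
- move=> t [[P l] [Fa _ ta]] C' h cl; have [o sl _] := F_facts.2 _ Fa.
  by apply: (closed_refl cl o sl) => //; apply: h.
- by move=> d w ts [a [/F_facts.2[_ _ /allP h _ /h]]].
- by move=> t [a [Fa _ ta]]; apply: Chase_const ta.
Qed.

(** What an equality axiom can add: reflexivity, symmetry and transitivity fall under the first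
    case; replacement falls under the second, with [a0] the fact being rewritten. *)
Definition derived C (rep : term S -> term S) (a : fact S) : Prop :=
  (exists t u, [/\ a = (EQ, [:: t; u]), dom C t, dom C u & rep t = rep u]) \/
  (exists a0, [/\ C a0, a0.1 <> EQ, subst_atom rep a = subst_atom rep a0
                & forall t, t \in a.2 -> dom C t]).

Lemma derived_dom C rep (H : set (fact S)) :
  (forall a, H a -> derived C rep a) -> dom (C `|` H) = dom C.
Proof.
move=> dH; apply/seteqP; split; last by apply: sub_dom; apply: subsetUl.
move=> t [a [[Ca|/dH[[u [v [-> //]]]|[a0 [_ _ _ h]]]] na ta]]; last exact: h.
by exists a.
Qed.

(** Derived facts bring no new elements, and the images of those not over [EQ] are already in [A];
    hence [A] and [rep] stay as they are. *)
Lemma simulates_derived A C rep (H : set (fact S)) :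
  simulates A C rep -> finite_set H -> (forall a, H a -> derived C rep a) ->
  simulates A (C `|` H) rep.
Proof.
move=> sim fH dH; have [h1 h2 h3 h4 h5 h6 h7 h8 h9 h10 h11 h12] := sim.
have CH : C `<=` C `|` H by apply: subsetUl.
split; rewrite ?(derived_dom dH) //.
- by rewrite finite_setU.
- move=> a [/h2//|/dH[[t [u [-> //]]]|[a0 [Ca0 n0 [e _] _]]]] _.
  by rewrite e; apply: h2.
- move=> a [/h3//|/dH[[t [u [-> /= _ _ _]]]|[a0 [Ca0 n0 [e1 e2] _]]]].
    by rewrite arity_EQ.
  by rewrite e1 -h3 // -(size_map rep) e2 size_map.
- by move=> C' h; apply: h5; apply: subset_trans h.
- move=> a [/h6//|/dH[[t [u [-> //]]]|[a0 [Ca0 n0 -> _]]]] _; exact: h6.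
- move=> t u [/h7//|/dH[[t' [u' [[-> ->] //]]]|[a0 [_ n0 [e _] _]]]].
  by case: n0.
- by move=> t dt C' h; apply: h8 => //; apply: subset_trans h.
- by move=> d w ts /h11[s e m]; exists s => //; apply: sub_matches m.
Qed.

Lemma eq_axiom_derived A C rep d s : simulates A C rep -> eq_axiom d ->
  matches s (tgd_body d) C -> forall a, a \in tgd_head d ->
  derived C rep (subst_atom s a).
Proof.
move=> sim; case=> [P o n|||P i o n] m a /=; rewrite ?mem_seq1.
- case/mapP=> i hi ->; left; exists (s i), (s i).
  have di : dom C (s i).
    exists (P, map s (iota 0 (arity P))); split; last exact: map_f.
      exact: (m _ (mem_head _ _)).
    exact: occurs_neq.
  by [].
- move=> /eqP->; left; exists (s 1), (s 0).
  by have /(sim_eq sim)[] := m _ (mem_head _ _).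
- move=> /eqP->; left; exists (s 0), (s 2).
  have /(sim_eq sim)[d0 _ e0] := m _ (mem_head _ _).
  have /(sim_eq sim)[_ d2 e2] : C (EQ, [:: s 1; s 2]).
    by apply: (m (EQ, [:: 1; 2])); rewrite !inE eqxx orbT.
  by rewrite e0.
- move=> /eqP->; right; exists (P, map s (iota 0 (arity P))).
  have Ca := m _ (mem_head _ _).
  have /(sim_eq sim)[_ dn en] : C (EQ, [:: s i; s (arity P)]).
    by apply: (m (EQ, [:: i; arity P])); rewrite !inE eqxx orbT.
  split=> //=; first exact: occurs_neq.
    rewrite /subst_atom /= -!map_comp; congr pair.
    rewrite map_set_nth ?size_iota //.
    (* The old and the new argument have the same image under [rep], so the rewritten fact has the
       same image as the original. *)
    have -> : (rep \o s) (arity P) =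
              nth ((rep \o s) 0) (map (rep \o s) (iota 0 (arity P))) i.
      by rewrite (nth_map 0) ?size_iota // nth_iota //= en.
    by rewrite set_nth_self // size_map size_iota.
  move=> t /mapP[v vi ->].
  case/mem_set_nth: vi => [|->//|vi]; first by rewrite size_iota.
  exists (P, map s (iota 0 (arity P))); split=> //; first exact: occurs_neq.
  exact: map_f.
Qed.

Definition st_step C C' : bool :=
  `[< exists r s, [/\ St EQ R r, applicable r s C & C' = apply_rule lt r s C] >].

Lemma simulates_facts_over A C rep : simulates A C rep ->
  C `<=` facts_over (dom C).
Proof.
move=> sim [P l] Ca; have /= sl := sim_arity sim Ca.
case: (eqVneq P EQ) => [e|/eqP n].
  split=> //; first by right.
  move: sl Ca; rewrite e arity_EQ; case: l => [|t [|u []]] //= _.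
  by move=> /(sim_eq sim)[dt du _] v; rewrite !inE => /orP[]/eqP->.
split=> //; first by left; apply: (sim_occurs sim Ca).
by move=> t tl; exists (P, l).
Qed.

(** A violated axiom is an applicable TGD whose head adds a missing fact over [dom C]. The domain
    does not grow, so the number [m] of missing facts decreases. *)
Lemma saturate A C rep : simulates A C rep ->
  exists l, [/\ path st_step C l, simulates A (last C l) rep
              & eq_closed (last C l)].
Proof.
move=> sim0; have fU := finite_facts_over (finite_dom (sim_fin sim0)).
have {fU} /finite_seqP[U eU] := fU.
(* The domain is frozen as [D], so that [U] stays the same while [C] grows in the induction. *)
have := erefl (dom C); move: {1 3}(dom C) eU => D eU eD.
pose m C := count (fun a => ~~ `[< C a >]) U.
have [n] := ubnP (m C); elim: n C sim0 eD => // n IH C sim eD; rewrite ltnS => le.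
case: (pselect (eq_closed C)) => [cl|]; first by exists [::].
move=> /existsNP[d] /existsNP[s] /not_implyP[ax] /not_implyP[mb nm].
have /existsNP[a /not_implyP[ah nCa]] := nm.
have dl := eq_axiom_datalog ax.
set H := [set subst_atom s a | a in [set` tgd_head d]].
have dH b : H b -> derived C rep b.
  by move=> [b' hb <-]; apply: eq_axiom_derived sim ax mb _ hb.
have fH : finite_set H by apply: finite_image; apply: finite_seq.
have sim' := simulates_derived sim fH dH.
have eD' : dom (C `|` H) = D by rewrite (derived_dom dH).
have [|l [pl siml cll]] := IH _ sim' eD'.
  apply: leq_trans le; apply: (@count_ltn _ _ _ _ (subst_atom s a)).
  - have : facts_over (dom (C `|` H)) (subst_atom s a).
      by apply: simulates_facts_over sim' _ _; right; exists a.
    by rewrite eD' eU.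
  - exact/asboolP.
  - by rewrite negbK; apply/asboolP; right; exists a.
  - by move=> b; apply: contra => /asboolP Cb; apply/asboolP; left.
exists ((C `|` H) :: l); split=> //=; rewrite pl andbT.
apply/asboolP; exists (TGD d), s; split; first exact: eq_axiom_St.
  by rewrite datalog_applicable.
by rewrite apply_datalog.
Qed.

(** * One rule application of [R] carried out on both sides *)

Lemma rule_atomP r a : R r -> a \in rule_atoms r ->
  occurs R a.1 /\ size a.2 = arity a.1.
Proof.
move=> Rr ar; have [/allP h _] := R_rules.2 _ Rr.
by split; [exists r => //; apply: map_f|apply/eqP/h].
Qed.

Lemma body_atom (r : rule S) a : a \in body r -> a \in rule_atoms r.
Proof. by case: r => //= d ab; rewrite mem_cat ab. Qed.

Lemma head_atom d a : a \in tgd_head d -> a \in rule_atoms (TGD d).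
Proof. by move=> ah; rewrite /= mem_cat ah orbT. Qed.

Lemma matches_dom r s C v : R r -> matches s (body r) C -> v \in vars (body r) ->
  dom C (s v).
Proof.
move=> Rr m /varsP[a ab va]; exists (subst_atom s a); split; first exact: m.
  by apply: occurs_neq; apply: (rule_atomP Rr (body_atom ab)).1.
exact: map_f.
Qed.

Lemma rep_matches A C rep r s : simulates A C rep -> R r ->
  matches s (body r) C -> matches (rep \o s) (body r) A.
Proof.
move=> sim Rr m a ab; rewrite -subst_atom_comp.
apply: (sim_rep sim); first exact: m.
by apply: occurs_neq; apply: (rule_atomP Rr (body_atom ab)).1.
Qed.

Lemma closed_sub A C rep : simulates A C rep -> eq_closed C -> A `<=` C.
Proof. by move=> sim cl; apply: (sim_sub sim). Qed.

(** If the Skolem term were present, [sim_skolem] would give a match of the head in [C]; composing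
    it with [rep] extends [s] to a head match in [A], against applicability. *)
Lemma skolem_fresh A C rep d s v : simulates A C rep -> A `<=` C ->
  R (TGD d) -> applicable (TGD d) s A -> v \in vars (tgd_head d) ->
  v \notin vars (tgd_body d) -> ~ dom C (skolemize d s v).
Proof.
move=> sim AC Rd [m ap] vh nvb; rewrite /skolemize (negbTE nvb).
move=> /(sim_skolem sim)[s0 es m0]; apply: ap.
exists (fun v => if v \in vars (tgd_body d) then s v else rep (skolemize d s0 v)).
  by move=> w ->.
move=> a ah; have := sim_rep sim (m0 a ah).
have [o _] := rule_atomP Rd (head_atom ah).
rewrite subst_atom_comp => /(_ (occurs_neq o)).
rewrite (@eq_subst_atom _ _ _ (fun v => if v \in vars (tgd_body d)
  then s v else rep (skolemize d s0 v))) // => w wa /=.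
have wh : w \in vars (tgd_head d) by apply/varsP; exists a.
case: ifP => // wb; rewrite /skolemize wb.
have wf : w \in frontier d by rewrite frontierP wh.
(* Equal Skolem arguments make [s0] and [s] agree on the frontier, and [rep] fixes the values of
   [s], which lie in [A]. *)
have /eq_in_map/(_ _ wf) <- := es.
by apply: (sim_fixed sim); apply: (@matches_dom (TGD d)) m _.
Qed.

(** The same [rep] works: the invented terms are not in [C], and outside [dom C] it is the
    identity. *)
Lemma simulates_tgd A C rep d s : simulates A C rep -> eq_closed C ->
  R (TGD d) -> applicable (TGD d) s A ->
  simulates (apply_rule lt (TGD d) s A) (apply_rule lt (TGD d) s C) rep.
Proof.
move=> sim cl Rd ap; have AC := closed_sub sim cl.
have [h1 h2 h3 h4 h5 h6 h7 h8 h9 h10 h11 h12] := sim.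
rewrite /=; set H := [set subst_atom (skolemize d s) a | a in [set` tgd_head d]].
have Hat a : H a -> occurs R a.1 /\ size a.2 = arity a.1.
  by case=> b bh <-; rewrite /= size_map; apply: (rule_atomP Rd (head_atom bh)).
have HEQ a : H a -> a.1 <> EQ by move=> /Hat[/occurs_neq].
have bodyA v : v \in vars (tgd_body d) -> dom A (s v).
  exact: (@matches_dom (TGD d)) ap.1.
have Hdom t : (exists2 a, H a & t \in a.2) ->
    [/\ rep t = t, chase_term t & forall w ts d', t = Skolem d' w ts ->
      exists2 s', ts = map s' (frontier d')
        & matches (skolemize d' s') (tgd_head d') (C `|` H)].
  case=> _ [b bh <-] /mapP[v vb ->].
  have vh : v \in vars (tgd_head d) by apply/varsP; exists b.
  case: (boolP (v \in vars (tgd_body d))) => hv.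
    have e : skolemize d s v = s v by rewrite /skolemize hv.
    have dC : dom C (s v) by apply: sub_dom AC _ (bodyA _ hv).
    rewrite e; split; [exact/h9/bodyA|exact: h12|].
    move=> w ts d' ew; move: dC; rewrite ew => /h11[s' es m].
    by exists s' => //; apply: sub_matches m; apply: subsetUl.
  have fr := skolem_fresh sim AC Rd ap vh hv.
  split; first exact: h10.
    rewrite /skolemize (negbTE hv); apply: Chase_skolem => //.
      by rewrite size_map.
    move=> t' /mapP[w]; rewrite frontierP => /andP[_ wb] ->.
    by apply/h12/(sub_dom AC)/bodyA.
  (* A new Skolem term is certified by [s] itself, as [H] is the whole instantiated head. *)
  rewrite /skolemize (negbTE hv) => w ts d' [<- _ <-].
  by exists s => // a ah; right; exists a.
have domH t C0 : dom (C0 `|` H) t -> dom C0 t \/ exists2 a, H a & t \in a.2.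
  by case=> a [[Ca|Ha] n ta]; [left; exists a|right; exists a].
split.
- by rewrite finite_setU; split=> //; apply: finite_image; apply: finite_seq.
- by move=> a [/h2//|/Hat[]].
- by move=> a [/h3//|/Hat[]].
- by move=> a [/h4//|/Hat[]].
- move=> C' CC' cl' a [Aa|Ha]; last by apply: CC'; right.
  by apply: h5 Aa => //; apply: subset_trans CC'; apply: subsetUl.
- move=> a [Ca|Ha] n; first by left; apply: h6.
  right; rewrite subst_atom_fixed // => t ta.
  by case: (Hdom t) => //; exists a.
- move=> t u [/h7[dt du e]|/HEQ //].
  by split=> //; apply: sub_dom dt || apply: sub_dom du; apply: subsetUl.
- move=> t /domH[dt|[[P l] Ha ta]] C' CC' cl'.
    by apply: h8 => //; apply: subset_trans CC'; apply: subsetUl.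
  have [-> _ _] := Hdom t (ex_intro2 _ _ (P, l) Ha ta).
  have [o sl] := Hat _ Ha.
  by apply: (closed_refl cl' o sl) => //; apply: CC'; right.
- by move=> t /domH[/h9//|/Hdom[]].
- by move=> t n; apply: h10 => dt; apply: n; apply: sub_dom dt; apply: subsetUl.
- move=> d' w ts /domH[/h11[s' e m]|/Hdom[_ _]]; last exact.
  by exists s' => //; apply: sub_matches m; apply: subsetUl.
- by move=> t /domH[/h12//|/Hdom[]].
Qed.

Definition merge (r : rule S) s : term S -> term S := match r with
  | TGD _ => id
  | EGD e =>
      let t := s (egd_lhs e) in
      let u := s (egd_rhs e) in
      if `[< lt t u >] then fun v => if `[< v = u >] then t else v
      else fun v => if `[< v = t >] then u else v
  end.

Lemma merge_lt r s A : applicable r s A ->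
  forall v, merge r s v = v \/ lt (merge r s v) v.
Proof.
case: r => [d|e] [_ /= neq] v; first by left.
case: asboolP => h; case: asboolP => [->|_]; try (by left); right=> //.
by case: (term_order_total lt_order neq).
Qed.

Lemma merge_depth r s A v : applicable r s A -> depth (merge r s v) <= depth v.
Proof.
case/merge_lt/(_ v) => [->//|h]; rewrite leqNgt; apply/negP.
move=> /(term_order_depth lt_order)/(term_order_trans lt_order h).
exact: (term_order_irr lt_order).
Qed.

(** While [A] collapses two elements, [C] only records their equality as an [EQ]-fact; the collapse
    is put into the representative map. *)
Lemma simulates_egd A C rep e s : simulates A C rep -> eq_closed C ->
  R (EGD e) -> applicable (EGD e) s A ->
  simulates (apply_rule lt (EGD e) s A)
    (apply_rule lt (TGD (egd_tgd e)) s C) (merge (EGD e) s \o rep).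
Proof.
move=> sim cl Re ap; have AC := closed_sub sim cl.
have [h1 h2 h3 h4 h5 h6 h7 h8 h9 h10 h11 h12] := sim.
have [el er] := egd_vars Re.
have dl : dom A (s (egd_lhs e)) by exact: (matches_dom Re ap.1 el).
have dr : dom A (s (egd_rhs e)) by exact: (matches_dom Re ap.1 er).
rewrite (apply_datalog _ _ (egd_tgd_datalog Re)).
set x := s (egd_lhs e) in dl; set y := s (egd_rhs e) in dr.
have -> : [set subst_atom s a | a in [set` tgd_head (egd_tgd e)]] =
    [set (EQ, [:: x; y])].
  apply/seteqP; split=> [b [a /=]|b ->]; first by rewrite mem_seq1 => /eqP -> <-.
  by exists (EQ, [:: egd_lhs e; egd_rhs e]) => //=; rewrite mem_seq1.
set H := [set (EQ, [:: x; y])].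
(* Whichever way the order decides, [t] is the term merged away and [u] the one that survives. *)
have [t [u [dt du tu exy [mE aE]]]] : exists t u, [/\ dom A t, dom A u, t <> u,
    (t = x /\ u = y) \/ (t = y /\ u = x) &
    merge (EGD e) s = (fun v => if `[< v = t >] then u else v) /\
    apply_rule lt (EGD e) s A = replace_term t u A].
  rewrite /= -/x -/y; case: asboolP => h.
    by exists y, x; split; [| |move=> eyx; case: ap.2|right|].
  by exists x, y; split; [| |exact: ap.2|left|].
rewrite aE mE /replace_term; set f := fun v => if `[< v = t >] then u else v.
have CH : C `<=` C `|` H by apply: subsetUl.
have Hn a : H a -> a.1 = EQ by move=> ->.
have domH : dom (C `|` H) = dom C.
  apply/seteqP; split; last exact: sub_dom.
  by move=> v [a [[Ca|/Hn//] n va]]; exists a.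
(* Closure makes each element of [A] equal to its image under the merge, by the new fact or by
   reflexivity; [sim_sub] and [sim_dom] rest on this. *)
have fA v C' : C `|` H `<=` C' -> eq_closed C' -> dom A v ->
    C' (EQ, [:: v; f v]).
  move=> CC' cl' [[P l] [Aa _ va]]; rewrite /f; case: asboolP => [->|_].
    have xy : C' (EQ, [:: x; y]) by apply: CC'; right.
    by case: exy => -[-> ->] //; apply: closed_sym xy.
  have [o sl] := h4 _ Aa.
  by apply: (closed_refl cl' o sl) => //; apply: CC'; left; apply: AC.
split; rewrite ?domH //.
- by rewrite finite_setU; split=> //; apply: finite_set1.
- by move=> a [/h2//|/Hn].
- by move=> a [/h3//|->]; rewrite arity_EQ.
- by move=> _ [a /h4[o sl] <-]; rewrite /= size_map.
- move=> C' CC' cl' _ [a Aa <-]; have [o sl] := h4 _ Aa.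
  have Ca : C' (subst_atom id a).
    by rewrite subst_atom_fixed //; apply: CC'; left; apply: AC.
  apply: closed_subst Ca => // v va; apply: fA => //.
  by exists a; split=> //; apply: occurs_neq.
- by move=> a [/h6 h|/Hn//] n; exists (subst_atom rep a); rewrite ?subst_atom_comp //; apply: h.
- move=> v w [/h7[dv dw /= ->]//|[-> ->]]; split; try exact: sub_dom AC _ _.
  rewrite /= !h9 // /f.
  by case: exy => -[<- <-]; do 2 case: asboolP => //.
- move=> v dv C' CC' cl' /=; apply: closed_trans (cl') (h8 _ dv _ _ cl') _.
    exact: subset_trans CC'.
  apply: fA => //; case: dv => a [Ca n va]; exists (subst_atom rep a).
  by split=> //; [apply: h6|apply: map_f].
(* Elements of the merged set have the form [f w], and [f] is idempotent because [t] and [u]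
   differ. *)
- move=> v [_ [[a Aa <-] n /mapP[w wa ->]]] /=.
  have dw : dom A w by exists a.
  have fn v' : v' <> t -> f v' = v' by rewrite /f; case: asboolP.
  case: (pselect (w = t)) => [->|nw]; last by rewrite fn // h9 // fn.
  have -> : f t = u by rewrite /f asboolT.
  by rewrite h9 // fn // => ut; apply: tu.
- move=> v n /=; rewrite h10 // /f; case: asboolP => // ev.
  by case: n; rewrite ev; apply: sub_dom AC _ _.
- by move=> d w ts /h11[s' es m]; exists s' => //; apply: sub_matches m.
Qed.

(** * Transfer of applicability between the two chases *)

Definition st_rule (r : rule S) : tgd S :=
  match r with TGD d => d | EGD e => egd_tgd e end.

Lemma st_rule_St r : R r -> St EQ R (TGD (st_rule r)).
Proof. by case: r => [d|e] h; [apply: St_tgd|apply: St_egd]. Qed.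

Lemma st_rule_body r : tgd_body (st_rule r) = body r.
Proof. by case: r. Qed.

Lemma applicable_simulates A C rep r s : simulates A C rep -> eq_closed C ->
  R r -> applicable r s A -> applicable (TGD (st_rule r)) s C.
Proof.
move=> sim cl Rr ap; have AC := closed_sub sim cl.
have fixA v : v \in vars (body r) -> rep (s v) = s v.
  by move=> hv; apply: (sim_fixed sim); apply: matches_dom Rr ap.1 hv.
case: r Rr ap fixA => [d|e] Rr [m ap] fixA.
  split; first exact: sub_matches m.
  case=> s' es m'; apply: ap; exists (rep \o s').
    by move=> v hv /=; rewrite es // fixA.
  move=> a ah; rewrite -subst_atom_comp; apply: (sim_rep sim); first exact: m'.
  by apply: occurs_neq; apply: (rule_atomP Rr (head_atom ah)).1.
have [el er] := egd_vars Rr.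
apply/(datalog_applicable (egd_tgd_datalog Rr)); first exact: sub_matches m.
(* An [EQ]-fact in [C] would give both sides the same representative, but they are elements of [A]
   and represent themselves. *)
by move=> /(_ _ (mem_head _ _))/(sim_eq sim)[_ _]; rewrite !fixA.
Qed.

(** In [C] each body value of [s] is [EQ] to its representative, so a head match in [A] found for
    [rep \o s] can be rewritten into one for [s]. *)
Lemma inapplicable_simulates A C rep r s : simulates A C rep -> eq_closed C ->
  R r -> matches s (body r) C -> ~ applicable r (rep \o s) A ->
  ~ applicable (TGD (st_rule r)) s C.
Proof.
move=> sim cl Rr m nap; have AC := closed_sub sim cl.
have eqv v : v \in vars (body r) -> C (EQ, [:: rep (s v); s v]).
  move=> hv; apply: (closed_sym cl); apply: (sim_dom sim) => //.
  exact: matches_dom Rr m hv.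
have mA := rep_matches sim Rr m.
case: r Rr m nap eqv mA => [d|e] Rr m nap eqv mA [_ ap].
  apply: nap; split=> // -[s' es m']; apply: ap.
  (* Existential variables keep their values in [A]; only body variables are moved back from
     representatives. *)
  exists (fun v => if v \in vars (tgd_body d) then s v else s' v).
    by move=> v ->.
  move=> a ah; have [o sl] := rule_atomP Rr (head_atom ah).
  have Ca := AC _ (m' a ah).
  apply: closed_subst Ca => // v va.
  case: ifP => hv; first by rewrite es //; apply: eqv.
  apply: (closed_refl cl o _ (AC _ (m' a ah))); last exact: map_f.
  by rewrite size_map.
have [el er] := egd_vars Rr.
have /(datalog_applicable (egd_tgd_datalog Rr) m) nm :
  applicable (TGD (egd_tgd e)) s C by split.
apply: nm => a; rewrite mem_seq1 => /eqP->; rewrite /subst_atom /=.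
apply: closed_trans cl (closed_sym cl (eqv _ el)) _.
suff -> : rep (s (egd_lhs e)) = rep (s (egd_rhs e)) by apply: eqv.
by apply: contrapT => ne; apply: nap.
Qed.

(** The segment begins with the translated rule, so it is non-empty even if nothing is left to
    saturate; this keeps the simulating chase infinite. *)
Lemma simulate_step A C rep r s : simulates A C rep -> eq_closed C ->
  R r -> applicable r s A ->
  exists l, [/\ 0 < size l, path st_step C l,
    simulates (apply_rule lt r s A) (last C l) (merge r s \o rep)
    & eq_closed (last C l)].
Proof.
move=> sim cl Rr ap.
have sim' : simulates (apply_rule lt r s A)
    (apply_rule lt (TGD (st_rule r)) s C) (merge r s \o rep).
  by case: r Rr ap => [d|e] Rr ap; [apply: simulates_tgd|apply: simulates_egd].
have [l [pl siml cll]] := saturate sim'.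
exists (apply_rule lt (TGD (st_rule r)) s C :: l); split=> //=.
rewrite pl andbT; apply/asboolP; exists (TGD (st_rule r)), s; split=> //.
  exact: st_rule_St.
exact: applicable_simulates sim cl Rr ap.
Qed.

(** * The infinite chase of [St] and its fairness *)

Lemma stable_uniformly (T : eqType) (U : Type) (x : nat -> T -> U) k (l : seq T) :
  (forall v, v \in l -> exists2 N, k <= N & forall j, N <= j -> x j v = x N v) ->
  exists2 N, k <= N & forall j, N <= j -> {in l, x j =1 x N}.
Proof.
elim: l => [|v l IH] h; first by exists k.
have [N1 k1 h1] := h v (mem_head _ _).
have [|N2 k2 h2] := IH; first by move=> w wl; apply: h; rewrite inE wl orbT.
exists (maxn N1 N2); first by rewrite leq_max k1.
move=> j; rewrite geq_max => /andP[j1 j2] w; rewrite inE => /orP[/eqP->|wl].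
  by rewrite (h1 j) // (h1 (maxn _ _)) // leq_maxl.
by rewrite (h2 j) // (h2 (maxn _ _)) // leq_maxr.
Qed.

Lemma st_step_sub C C' : st_step C C' -> C `<=` C'.
Proof. by move=> /asboolP[_ [s [/StP[d -> _] _ ->]]] a Ca; left. Qed.

Lemma infinite_chase_St (A : nat -> option (set (fact S))) : chase_sequence lt R F A -> ~ finite_sequence A ->
  exists2 A', chase_sequence lt (St EQ R) F A' & ~ finite_sequence A'.
Proof.
move=> ch inf.
have /choice[a ea] : forall i, exists B, A i = Some B.
  by move=> i; case e: (A i) => [B|]; [exists B|case: inf; exists i].
have /choice[p hp] : forall i, exists q : rule S * (var -> term S),
    [/\ R q.1, applicable q.1 q.2 (a i) & a i.+1 = apply_rule lt q.1 q.2 (a i)].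
  move=> i; have [B [r [s]]] := chase_step ch (ea i.+1).
  by rewrite ea => -[[<-] Rr ap e]; exists (r, s).
pose rep := fix rep i :=
  if i is j.+1 then merge (p j).1 (p j).2 \o rep j else id.
have a0 : a 0 = F by have := chase_start ch; rewrite ea => -[].
have [l0 [p0 sim0 cl0]] := saturate simulates_start.
(* Segments are chosen for arbitrary fact sets, with the invariant as a premise, so that [B] can be
   defined by recursion before the invariant is proved for it. *)
have /choice[seg hseg] : forall q : nat * set (fact S), exists l,
    simulates (a q.1) q.2 (rep q.1) -> eq_closed q.2 ->
    [/\ 0 < size l, path st_step q.2 l,
      simulates (a q.1.+1) (last q.2 l) (rep q.1.+1) & eq_closed (last q.2 l)].
  move=> [i B] /=; case: (pselect (simulates (a i) B (rep i) /\ eq_closed B)).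
    move=> [sim cl]; have [Rr ap ->] := hp i.
    by have [l hl] := simulate_step sim cl Rr ap; exists l.
  by move=> n; exists [::] => sim cl; case: n.
pose B := fix B i := if i is j.+1 then last (B j) (seg (j, B j)) else last F l0.
have hB i : simulates (a i) (B i) (rep i) /\ eq_closed (B i).
  elim: i => [|i [sim cl]]; first by rewrite a0.
  by have [] := hseg (i, B i) sim cl.
have [|C [C0 stC] [n le_n Cn]] :=
    @flatten_steps _ st_step F l0 B (fun i => seg (i, B i)) p0 erefl.
  by move=> i; have [sim cl] := hB i; have [] := hseg (i, B i) sim cl.
have monoC k k' : k <= k' -> C k `<=` C k'.
  move=> /subnK <-; elim: (k' - k) => // m IH; rewrite addSn.
  exact: subset_trans IH (st_step_sub (stC _)).
have depth_rep i t : depth (rep i t) <= depth t.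
  elim: i => //= i IH; apply: leq_trans IH.
  by have [_ ap _] := hp i; apply: merge_depth ap.
exists (fun k => Some (C k)); last by case.
split; first by rewrite C0.
  move=> k _ [<-]; have /asboolP[r [s [Rr ap e]]] := stC k.
  by exists (C k), r, s.
move=> k _ _ s [<-] /StP[d -> hd] [m _].
have CB i : k < i -> C k `<=` B i.
  by move=> ki; rewrite -Cn; apply: monoC; apply: leq_trans (ltnW ki) (le_n i).
suff [i ki nap] : exists2 i, k < i & ~ applicable (TGD d) s (B i).
  by exists (n i), (B i); split=> //; rewrite ?Cn //; apply: leq_trans ki _.
have [ax|[r Rr ed]] : eq_axiom d \/ exists2 r, R r & d = st_rule r.
  case: hd => [Rd|[e Re ->]|]; [right|right|by left].
    by exists (TGD d).
  by exists (EGD e).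
  (* An equality axiom is inapplicable at the end of the next round, as [B k.+1] is closed. *)
  exists k.+1 => //.
  have mB : matches s (tgd_body d) (B k.+1) by apply: sub_matches m; apply: CB.
  rewrite datalog_applicable //; last exact: eq_axiom_datalog.
  by move=> nm; apply: nm; apply: (hB k.+1).2 ax mB.
have {}m i : k < i -> matches s (body r) (B i).
  by move=> ki; rewrite -st_rule_body -ed; apply: sub_matches m; apply: CB.
have [|N kN hN] := @stable_uniformly _ _ (fun j v => rep j (s v)) k.+1 (vars (body r)).
  move=> v hv.
  apply: (@descending_stabilises _ lt
    [set t | chase_term t /\ depth t < (depth (s v)).+1] (fun j => rep j (s v))).
  - exact: term_order_irr lt_order.
  - exact: term_order_trans lt_order.
  - exact: finite_chase_terms.
  - move=> j kj; split; last by rewrite ltnS.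
    (* The representative is an element of [a j], hence of [B j], and so a chase term. *)
    have [sim cl] := hB j; apply: (sim_term sim).
    apply: (sub_dom (closed_sub sim cl)).
    exact: matches_dom Rr (rep_matches sim Rr (m j kj)) hv.
  - by move=> j; have [_ ap _] := hp j; apply: (merge_lt ap).
(* From [N] on the represented match is constant on the body, so fairness of the given chase for the
   match at [N] also speaks of the later ones. *)
have [i Ni nap] : exists2 i, N <= i & ~ applicable r (rep i \o s) (a i).
  case: (pselect (applicable r (rep N \o s) (a N))) => ap; last by exists N.
  have [j [Bj [Nj]]] := chase_fair ch (ea N) Rr ap.
  rewrite ea => -[<-] nap; exists j; first exact: ltnW.
  apply: contra_not nap; apply: applicable_ext => // v hv.
  exact: (hN j (ltnW Nj) v hv).
have ki : k < i by apply: leq_trans Ni.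
exists i => //; rewrite ed; have [sim cl] := hB i.
exact: inapplicable_simulates (m i ki) nap.
Qed.

End Rules.

Theorem theorem1 (S : signature) (lt : term S -> term S -> Prop) (EQ : S)
    (R : set (rule S)) :
  term_order lt ->
  rule_set R ->
  arity EQ = 2 -> ~ occurs R EQ ->
  chase_terminates lt (St EQ R) ->
  chase_terminates lt R.
Proof.
move=> lt_order R_rules arity_EQ EQ_fresh St_term F F_facts A ch.
apply: contrapT => inf.
have [A' ch'] := infinite_chase_St lt_order R_rules arity_EQ EQ_fresh F_facts ch inf.
apply; apply: St_term ch'; split; first by case: F_facts.
move=> a /F_facts.2[[r Rr hr] sa ca]; split=> //.
(* The translation of a rule retains its predicates, so [F] is also a fact set for [St EQ R]. *)
exists (TGD (st_rule EQ r)); first exact: st_rule_St.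
by case: r Rr hr => //= e Re; rewrite map_cat mem_cat => ->.
Qed.
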